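(* Let $(X,\triangleright)$ be a finite simple crossed set. Then the following are equivalent. (1) $X$ has $p^t$ elements, for some prime number $p$ and some $t\in\mathbb N$, $t\ge 1$. (2) The group $\mathrm{Inn}_\triangleright(X)$ is solvable. (3) There are a prime number $p$, an integer $t\ge 1$, an elementary abelian group $N$ of order $p^t$, and a non-trivial automorphism $x\in\mathrm{Aut}(N)$ acting irreducibly on $N$, such that $\mathrm{Inn}_\triangleright(X)\simeq N\rtimes C$, where $C=\langle x\rangle\subset\mathrm{Aut}(N)$. (4) There are a prime number $p$ and an integer $t\ge 1$ such that $X$ is isomorphic to an affine crossed set $(\mathbb F_p^t,T)$ where $T\in\mathrm{GL}(t,\mathbb F_p)$ acts irreducibly.
   Context: A rack is a pair $(X,\triangleright)$ where $X$ is a non-empty set and $\triangleright:X\times X\to X$ is such that each $\phi_i(j)=i\triangleright j$ is a bijection of $X$ and $i\triangleright(j\triangleright k)=(i\triangleright j)\triangleright(i\triangleright k)$ for all $i,j,k$. A crossed set is a rack such that $i\triangleright i=i$ for all $i$, and $j\triangleright i=i$ whenever $i\triangleright j=j$. Morphisms are maps preserving $\triangleright$. A rack is trivial if $i\triangleright j=j$ for all $i,j$. A rack $X$ is simple if it is not trivial and, for every surjective rack morphism $\pi:X\to Y$, $\mathrm{card}\,Y$ is either $1$ or $\mathrm{card}\,X$. $\mathrm{Inn}_\triangleright(X)$ is the subgroup of the symmetric group of $X$ generated by $\{\phi_i: i\in X\}$. For an abelian group $A$ and $g\in\mathrm{Aut}(A)$, the affine crossed set $(A,g)$ is $A$ with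 $x\triangleright y=x+g(y-x)$. *)

(* Defs.v *)
From HB Require Import structures.
From mathcomp Require Import all_boot all_algebra all_fingroup all_solvable.
Set Implicit Arguments.
Unset Strict Implicit.
Unset Printing Implicit Defensive.
Import GroupScope GRing.Theory.

Definition is_rack (X : Type) (op : X -> X -> X) : Prop :=
  [/\ inhabited X,
      forall i, bijective (op i)
    & forall i j k, op i (op j k) = op (op i j) (op i k)].

Definition is_crossed_set (X : Type) (op : X -> X -> X) : Prop :=
  [/\ is_rack op,
      forall i, op i i = i
    & forall i j, op i j = j -> op j i = i].

Definition rack_morphism (X Y : Type) (opX : X -> X -> X) (opY : Y -> Y -> Y)
    (f : X -> Y) : Prop :=
  forall i j, f (opX i j) = opY (f i) (f j).

Definition rack_isomorphic (X Y : Type) (opX : X -> X -> X)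
    (opY : Y -> Y -> Y) : Prop :=
  exists2 f : X -> Y, bijective f & rack_morphism opX opY f.

Definition trivial_rack (X : Type) (op : X -> X -> X) : Prop :=
  forall i j, op i j = j.

(* A surjective image of the finite set X is finite, so it is enough to let Y
   range over finite types. *)
Definition simple_rack (X : finType) (op : X -> X -> X) : Prop :=
  [/\ is_rack op,
      ~ trivial_rack op
    & forall (Y : finType) (opY : Y -> Y -> Y) (f : X -> Y),
        is_rack opY -> rack_morphism op opY f -> (forall y, exists x, f x = y) ->
        #|Y| = 1%N \/ #|Y| = #|X|].

(* The generating set consists of the permutations s equal to phi_i = op i for
   some i; for a rack every phi_i is such a permutation. *)
Definition Inn (X : finType) (op : X -> X -> X) : {group {perm X}} :=
  <<[set s : {perm X} | [exists i, [forall j, s j == op i j]]]>>%G.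

Definition affine (A : zmodType) (g : A -> A) (x y : A) : A :=
  (x + g (y - x))%R.

(* Matrices act on row vectors on the right, so that the subspaces are the row
   spaces of the matrices U. *)
Definition irreducible_mx (F : fieldType) (t : nat) (T : 'M[F]_t) : Prop :=
  (0 < t)%N /\
  forall U : 'M[F]_t, stablemx U T -> U = 0%R \/ row_full U.

(* Main.v *)
Require Import Defs.
From HB Require Import structures.
From mathcomp Require Import all_boot all_order all_algebra all_fingroup all_solvable.
From mathcomp Require Import all_field all_character.
Set Implicit Arguments.
Unset Strict Implicit.
Unset Printing Implicit Defensive.
Import GroupScope GRing.Theory.

(** Write phi_i for the permutation i |> _ and G for the group they generate.
    Conjugation by g in G sends phi_i to phi_(g i). Any map on X compatible with
    the operation is constant or injective, by simplicity. Applied to phi this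
    gives an injection of X onto one conjugacy class generating G, which has
    trivial center; applied to the orbit map of a normal subgroup N <> 1, it
    shows that N is transitive on X. Hence all phi_i are congruent modulo N, so
    that G = N <phi_i> and G' is contained in N: G' is the unique minimal normal
    subgroup of G.

    From (1) to (2). The class of x = phi_i has p^a elements. If the p-core of G
    is nontrivial, it contains G', so that G' is a p-group and G is solvable.
    Otherwise the p-part of x, whose class also has p-power size and which
    therefore lies in the p-core, is trivial; as G/G' is generated by the image
    of x, p does not divide |G : G'|. It is then enough to show that G' is a
    p-group ([primepow_class_der1_pgroup]), a relative of Burnside's theorem on
    classes of prime power size.

    Suppose that a prime q <> p divides |G'| and let y in G' have order q. The
    class sum of x acts on the irreducible character chi as the scalar
    |x^G| chi(x) / chi(1). Multiplying its Galois conjugates, which are the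
    scalars of the classes of powers of x, gives rational integers m(chi). Let B
    be the set of chi with m(chi) prime to q. This is a union of q-blocks, and so
    the sum of chi(1) chi(y) over B is zero ([block_sum_eq0]). No block theory is
    required: chi |-> m(chi)^(2(q-1)q^n) tends q-adically to the indicator of B,
    whereas the sum over all chi of chi(1) chi(y) m(chi)^(2(q-1)q^n) is |G| times
    the number of words of length q^n, in a suitable alphabet, with product
    y^-1. Rotating the words shows that this number tends q-adically to 0,
    because y is not a q^k-th power for large k ([necklace_dvd]).

    On the other hand a nonlinear chi in B satisfies chi(x) <> 0, and chi(1) is
    then divisible by p, by Burnside's argument ([coprime_degree_support_cfcenter]).
    All linear characters are in B, since m is a power of p up to sign on them,
    and they take the value 1 at y. The sum is therefore |G : G'| modulo p, which
    contradicts its vanishing.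

    From (2) to (3). Now N = G' is elementary abelian. The intersection of <x>
    with the centralizer of N is central, hence trivial; thus <x> is a faithful
    complement of N, irreducible on N because N is a minimal normal subgroup.

    From (3) to (4). The group G is solvable, so N = G' is again elementary
    abelian; being transitive and abelian, it is regular on X. The bijection of N
    with X sending n to n(i) transports the operation to
    (a, b) |-> a (a^-1 b)^x, the affine structure of conjugation by x.

    From (4) to (1), one counts row vectors. *)

(** * Counting words up to rotation *)

Section Necklace.
Local Open Scope nat_scope.
Variables (gT : finGroupType) (T : finType) (w : T -> gT).

(** A word fixed by a rotation of k letters is a power of its prefix of
    length k. *)
Lemma prod_rot_periodic (k j : nat) (s : seq T) :
  seq.rot k s = s -> size s = (j.+1 * k)%N ->
  (\prod_(a <- s) w a = (\prod_(a <- take k s) w a) ^+ j.+1)%g.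
Proof.
elim: j s => [|j IHj] s rotk size_s.
  by rewrite mul1n in size_s; rewrite -size_s take_size expg1.
pose u := take k s; pose v := drop k s.
have def_s: s = u ++ v by rewrite cat_take_drop.
have size_u: size u = k by rewrite size_takel // size_s mulSn leq_addr.
have size_v: size v = (j.+1 * k)%N by rewrite size_drop size_s mulSn addKn.
have vu: v ++ u = u ++ v by rewrite -def_s -[RHS]rotk.
have take_v: take k v = u.
  rewrite -(takel_cat u) ?size_v ?leq_pmull // vu.
  by rewrite -size_u take_size_cat.
have rot_v: seq.rot k v = v.
  rewrite /seq.rot take_v; apply/eqP; have /eqP := vu.
  by rewrite -{1}(cat_take_drop k v) take_v -catA eqseq_cat // eqxx.
by rewrite {1}def_s big_cat /= (IHj v rot_v size_v) take_v -expgS.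
Qed.

Variable G : {group gT}.
Hypothesis wG : forall a, w a \in G.

(** Rotating a word conjugates its product. A word whose orbit has q^s elements
    is a q^(n-s)-th power, and so is its product; since q divides the order of
    that product, q^(n-s+1) divides |G|, which bounds every orbit size below. *)
Lemma necklace_dvd (q n : nat) (y : gT) :
    prime q -> y \in G -> q %| #[y] ->
  q ^ (n - logn q #|G|) %|
    #|[set t : (q ^ n).-tuple T | (\prod_(a <- t) w a)%g \in (y ^: G)%g]|.
Proof.
move=> q_pr Gy q_y; set N := q ^ n; set W := [set t | _].
have N_gt0: 0 < N by rewrite expn_gt0 prime_gt0.
have rot_inj: injective (fun t : N.-tuple T => rot_tuple 1 t).
  by move=> t1 t2 [] /rot_inj /val_inj.
pose r : {perm N.-tuple T} := perm rot_inj.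
have rE k t: k <= N -> val ((r ^+ k)%g t) = seq.rot k t.
  elim: k => [|k IHk] lekN; first by rewrite expg0 perm1 rot0.
  by rewrite expgSr permM permE /= IHk ?(ltnW lekN) // -rotS ?size_tuple.
have r_order: #[r]%g %| N.
  rewrite order_dvdn; apply/eqP/permP=> t; apply: val_inj.
  by rewrite rE // perm1 /= -{1}(size_tuple t) rot_size.
have Gprod (s : seq T) : (\prod_(a <- s) w a)%g \in G.
  by apply: group_prod.
have actsW: [acts <[r]>%g, on W | 'P].
  rewrite cycle_subG; apply/astabsP => t.
  rewrite !inE /= /aperm /r permE /=.
  case: t => [[|a s] /= sz]; first by rewrite rot_oversize.
  rewrite rot1_cons big_cons -cats1 big_cat big_seq1 /=.
  have -> : (\prod_(i <- s) w i * w a = (w a * \prod_(i <- s) w i) ^ w a)%g.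
    by rewrite conjgE -mulgA mulKg.
  by rewrite class_sym classGidl ?wG // class_sym.
rewrite -(acts_sum_card_orbit actsW) dvdn_sum // => _ /imsetP[t Wt ->].
have [s le_s_n orb_s] : exists2 s, s <= n & #|orbit 'P <[r]>%g t| = q ^ s.
  apply/(dvdn_pfactor _ _ q_pr); apply: dvdn_trans r_order.
  by rewrite orderE -(card_orbit_stab 'P _ t) dvdn_mulr.
rewrite orb_s dvdn_exp2l //.
have rot_s: seq.rot (q ^ s) t = t.
  rewrite -rE ?leq_pexp2l ?prime_gt0 // permX -orb_s.
  have -> : orbit 'P <[r]>%g t = porbit r t by rewrite porbit.unlock.
  by rewrite iter_porbit.
set u := (\prod_(a <- take (q ^ s) t) w a)%g.
have q_gt0 : 0 < q ^ (n - s) by rewrite expn_gt0 prime_gt0.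
have def_u: (\prod_(a <- t) w a)%g = (u ^+ (q ^ (n - s)))%g.
  rewrite -[q ^ (n - s)]prednK //; apply: prod_rot_periodic => //.
  by rewrite prednK // size_tuple -expnD subnK.
move: Wt; rewrite inE def_u => /imsetP[z Gz Dy].
have q_u: q %| #[u ^+ (q ^ (n - s))]%g by rewrite Dy orderJ.
have Gu : u \in G by apply: Gprod.
have: q ^ (n - s).+1 %| #|G|.
  apply: dvdn_trans (order_dvdG Gu); rewrite (orderXpfactor (erefl _) q_pr q_u).
  by rewrite expnSr dvdn_mul.
by rewrite pfactor_dvdn // leq_subLR addnC -leq_subLR => /ltnW.
Qed.
End Necklace.

(** * Powers tending q-adically to 0 or 1 *)

Section PrimePowerCongruence.
Local Open Scope ring_scope.

(** Each q-th power gains a factor q: in u^q - v^q = (u - v) (sum of u^(q-1-i) v^i)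
    the second factor is q u^(q-1) modulo u - v. *)
Lemma dvdz_sub_exp_primepow (q k n : nat) (u v : int) : (0 < k)%N ->
  (q%:Z ^+ k %| u - v)%Z -> (q%:Z ^+ (n + k) %| u ^+ (q ^ n) - v ^+ (q ^ n))%Z.
Proof.
move=> k_gt0 q_uv; elim: n => [|n IHn]; first by rewrite !expr1.
rewrite addSn exprSr expnSr !exprM.
set x := u ^+ _ in IHn *; set y := v ^+ _ in IHn *.
rewrite subrXX dvdz_mul //.
have q_yx: (q%:Z %| y - x)%Z.
  rewrite -opprB rpredN; apply: dvdz_trans IHn.
  by rewrite -(prednK k_gt0) addnS exprS dvdz_mulr.
(* All terms are congruent to x ^+ q.-1 modulo q. *)
rewrite -[\sum_(i < q) _](subrK (\sum_(i < q) x ^+ q.-1)).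
rewrite rpredD //; last by rewrite sumr_const card_ord -mulr_natl natz dvdz_mulr.
rewrite -sumrB rpred_sum // => i _.
have le_i_q: (i <= q.-1)%N by rewrite -ltnS prednK // (leq_trans _ (ltn_ord i)).
rewrite -[in X in _ - X](subnK le_i_q) exprD -mulrBr dvdz_mull //.
by rewrite subrXX dvdz_mulr.
Qed.

(** Fermat's little theorem, then the previous lemma. The square makes the base
    a natural number without changing its divisibility by q. *)
Lemma exp_primepow_indicator (q n : nat) (m : int) : prime q ->
  (q%:Z ^+ n %| (m ^+ 2 ^+ q.-1) ^+ (q ^ n) - (~~ (q %| m)%Z)%:R)%Z.
Proof.
move=> q_pr; have q_gt0 := prime_gt0 q_pr; set b := ~~ _.
suffices q_mb: (q%:Z ^+ 1 %| m ^+ 2 ^+ q.-1 - b%:R)%Z.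
  have -> : b%:R = b%:R ^+ (q ^ n) :> int.
    by case: b {q_mb}; rewrite ?expr1n // expr0n expn_eq0 eqn0Ngt q_gt0.
  by apply: dvdz_trans (dvdz_sub_exp_primepow n _ q_mb); rewrite // exprD dvdz_mulr.
rewrite {}/b expr1; have [q_m | q'm] := boolP (q%:Z %| m)%Z.
  rewrite subr0 -exprM -(@prednK (2 * q.-1)).
    by rewrite exprS dvdz_mulr.
  by rewrite muln_gt0 -subn1 subn_gt0 prime_gt1.
set c := (`|m| ^ 2)%N; have c_gt0: (0 < c)%N.
  by rewrite expn_gt0 absz_gt0 orbF; apply: contraNneq q'm => ->; rewrite dvdz0.
have -> : m ^+ 2 = c%:Z.
  by rewrite [m]intEsign exprMn sqrr_sign mul1r /c -[RHS]natz natrX natz.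
have co_qc: coprime q c by rewrite prime_coprime // Euclid_dvdX // andbT.
clearbody c; have cq_gt0: (0 < c ^ q.-1)%N by rewrite expn_gt0 c_gt0.
have -> : c%:Z ^+ q.-1 - true%:R = (c ^ q.-1 - 1)%N%:Z.
  by rewrite -!natz natrB // natrX.
rewrite dvdzE /= -(Gauss_dvdr _ co_qc) mulnBr -expnS prednK // muln1.
by rewrite -eqn_mod_dvd ?fermat_little // -[c in (c <= _)%N]expn1 leq_pexp2l.
Qed.
End PrimePowerCongruence.

(** * Scalars by which products of conjugacy classes act on characters *)

Section Scalars.
Local Open Scope ring_scope.
Import Num.Theory.
Variables (gT : finGroupType) (G : {group gT}).
Implicit Types (i : Iirr G) (x y g : gT).

(** The central character of chi_i at the class sum of x. *)
Definition class_scalar x i : algC := #|x ^: G|%:R * 'chi_i x / 'chi_i 1%g.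

(** Schur's lemma: the class sum of x is central in the group algebra, so that
    the representation affording chi_i sends it to a scalar matrix; take traces
    after multiplying by the image of g. *)
Lemma sum_class_irr i x g : x \in G -> g \in G ->
  \sum_(z in x ^: G) 'chi_i (z * g)%g = class_scalar x i * 'chi_i g.
Proof.
move=> Gx Gg; pose k := enum_rank_in (classes1 G) (x ^: G).
have Dk: enum_val k = x ^: G by rewrite enum_rankK_in ?classes1 ?mem_classes.
have kx: x \in enum_val k by rewrite Dk class_refl.
have sKG z: z \in x ^: G -> z \in G by apply/subsetP/class_subG.
have sumK: \sum_(z in x ^: G) 'Chi_i z = (class_scalar x i)%:M.
  rewrite -[class_scalar x i](gring_mode_class_sum_eq i kx).
  rewrite -irr_gring_center ?gring_class_sum_central // /gring_class_sum Dk.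
  rewrite /gset_mx linear_sum; apply: eq_bigr => z /sKG Gz.
  by rewrite -(gring_opG 'Chi_i Gz).
have chiE z: z \in G -> 'chi_i z = \tr ('Chi_i z).
  by move=> Gz; rewrite -irrRepr cfunE Gz mulr1n.
transitivity (\tr ((\sum_(z in x ^: G) 'Chi_i z) *m 'Chi_i g)).
  rewrite mulmx_suml raddf_sum; apply: eq_bigr => z /sKG Gz.
  by rewrite chiE ?groupM // repr_mxM.
by rewrite sumK mul_scalar_mx mxtraceZ -chiE.
Qed.

(** The element of the group algebra that sums the values of w acts on the
    module of chi_i, as far as characters can tell, as the scalar m i. Using a
    family w in place of coefficients turns powers of this element into counts
    of words. *)
Definition acts_by_scalars (T : finType) (w : T -> gT) (m : Iirr G -> algC) :=
  (forall t, w t \in G) /\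
  (forall i g, g \in G -> \sum_t 'chi_i (w t * g)%g = m i * 'chi_i g).

Definition scalar_family m := exists (T : finType) (w : T -> gT), acts_by_scalars w m.

Lemma scalar_family_class x : x \in G -> scalar_family (class_scalar x).
Proof.
move=> Gx; exists {z | z \in x ^: G}, val; split=> [z | i g Gg].
  exact: subsetP (class_subG Gx (subxx G)) _ (valP z).
by rewrite -sum_class_irr // [RHS]big_sub.
Qed.

Lemma scalar_familyM m1 m2 :
  scalar_family m1 -> scalar_family m2 -> scalar_family (fun i => m1 i * m2 i).
Proof.
move=> [T1 [w1 [Gw1 m1E]]] [T2 [w2 [Gw2 m2E]]].
exists (T1 * T2)%type, (fun t => w1 t.1 * w2 t.2)%g; split=> [t | i g Gg].
  exact: groupM.
rewrite -(pair_bigA _ (fun t1 t2 => 'chi_i (w1 t1 * w2 t2 * g)%g)) exchange_big /=.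
rewrite -mulrA -m2E // mulr_sumr; apply: eq_bigr => t2 _.
by rewrite -m1E ?groupM //; apply: eq_bigr => t1 _; rewrite mulgA.
Qed.

Lemma scalar_family1 : scalar_family (fun=> 1).
Proof.
exists unit, (fun=> 1%g); split=> [_ | i g Gg]; first exact: group1.
by rewrite (big_pred1 tt) ?mul1g ?mul1r // => -[].
Qed.

Lemma scalar_family_prod (I : Type) (r : seq I) (m : I -> Iirr G -> algC) :
  (forall a, scalar_family (m a)) -> scalar_family (fun i => \prod_(a <- r) m a i).
Proof.
move=> wm; elim: r => [|a r [T [w [Gw IHr]]]].
  have [T [w [Gw wE]]] := scalar_family1; exists T, w; split=> // i g Gg.
  by rewrite big_nil wE.
have wr: scalar_family (fun i => \prod_(b <- r) m b i) by exists T, w.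
have [T' [w' [Gw' wE]]] := scalar_familyM (wm a) wr.
by exists T', w'; split=> // i g Gg; rewrite big_cons wE.
Qed.

Lemma acts_by_scalars_tuple (T : finType) (w : T -> gT) m n i g :
    acts_by_scalars w m -> g \in G ->
  \sum_(t : n.-tuple T) 'chi_i (\prod_(a <- t) w a * g)%g = m i ^+ n * 'chi_i g.
Proof.
move=> [Gw wE]; elim: n => [|n IHn] in g * => Gg.
  rewrite (big_pred1 [tuple]) ?big_nil ?mul1g ?mul1r // => t.
  by rewrite [t]tuple0 /= eqxx.
pose h (u : T * n.-tuple T) := [tuple of u.1 :: u.2].
have hbij: bijective h.
  exists (fun t : n.+1.-tuple T => (thead t, [tuple of behead t])).
    by case=> a t; rewrite /h /= theadE; congr (_, _); apply: val_inj.
  by move=> t; rewrite /h [RHS]tuple_eta.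
rewrite (reindex h) /=; last exact: onW_bij.
rewrite -(pair_bigA _ (fun a (t : n.-tuple T) =>
                         'chi_i (\prod_(b <- a :: t) w b * g)%g)) /=.
rewrite exchange_big exprS /= -mulrA -IHn // mulr_sumr; apply: eq_bigr => t _.
have Gt: (\prod_(a <- t) w a)%g \in G by apply: group_prod.
by rewrite -wE ?groupM //; apply: eq_bigr => a _; rewrite big_cons mulgA.
Qed.

(** Frobenius' counting formula, from the expansion of the regular character. *)
Lemma sum_scalars_exp (T : finType) (w : T -> gT) m n y :
    acts_by_scalars w m -> y \in G ->
  \sum_i 'chi_i 1%g * 'chi_i y * m i ^+ n
    = (#|G| * #|[set t : n.-tuple T | (\prod_(a <- t) w a * y)%g == 1%g]|)%:R.
Proof.
move=> wm Gy; transitivity (\sum_(t : n.-tuple T) cfReg G (\prod_(a <- t) w a * y)%g).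
  rewrite cfReg_sum; under [RHS]eq_bigr do rewrite sum_cfunE.
  rewrite exchange_big; apply: eq_bigr => i _ /=.
  under [RHS]eq_bigr do rewrite cfunE.
  by rewrite -mulr_sumr (acts_by_scalars_tuple _ _ wm) // mulrA mulrAC.
under eq_bigr do rewrite cfRegE mulrb.
rewrite -big_mkcond sumr_const natrM mulr_natr; congr (_ *+ _).
by apply: eq_card => t; rewrite !inE.
Qed.

(** The counting formula shows that the number of words with product z^-1 is a
    class function of z. The rotation argument bounds the number of words with
    product in the class of y^-1, which is therefore |y^G| times the number of
    those with product y^-1. *)
Lemma scalar_family_exp_dvd m (q n : nat) y :
    scalar_family m -> prime q -> y \in G -> (q %| #[y])%N ->
  exists c : nat, \sum_i 'chi_i 1%g * 'chi_i y * m i ^+ (q ^ n)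
    = (c * q ^ (n - logn q #|G|))%:R.
Proof.
move=> [T [w wm]] q_pr Gy q_y; have [Gw _] := wm.
pose W z := [set t : (q ^ n).-tuple T | (\prod_(a <- t) w a * z)%g == 1%g].
rewrite (sum_scalars_exp _ wm) // -/(W y).
have Wy z: z \in y ^: G -> #|W z| = #|W y|.
  case/imsetP=> g Gg ->; apply/eqP; rewrite -(eqn_pmul2l (cardG_gt0 G)).
  rewrite -(eqr_nat algC) -!(sum_scalars_exp _ wm) ?groupJ //; apply/eqP.
  by apply: eq_bigr => i _; rewrite cfunJ.
have := necklace_dvd Gw n q_pr (groupVr Gy); rewrite orderV => /(_ q_y).
set Y := [set t | _].
have YE t : (t \in Y) = ((\prod_(a <- t) w a)^-1%g \in y ^: G).
  by rewrite inE classVg mem_invg.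
have -> : #|Y| = (#|y ^: G| * #|W y|)%N.
  rewrite -sum1_card.
  rewrite (partition_big (fun t : _.-tuple T => (\prod_(a <- t) w a)^-1%g)
                         (mem (y ^: G))) /=; last by move=> t; rewrite YE.
  rewrite -sum_nat_const; apply: eq_bigr => z yGz; rewrite sum1_card -(Wy z) //.
  apply: eq_card => t; rewrite unfold_in /= YE inE -eq_invg_mul.
  by case: eqP => [-> | _]; rewrite ?andbF // yGz.
case/dvdnP=> c Dc; exists (#|'C_G[y]| * c)%N; congr _%:R.
by rewrite -mulnA -Dc mulnA -index_cent1 Lagrange // subsetIl.
Qed.

End Scalars.

(** * Integrality and Galois conjugation *)

Section Galois.
Local Open Scope ring_scope.
Import Order.TTheory Num.Theory.
Variables (gT : finGroupType) (G : {group gT}).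

(** On <x> every character is a sum of linear ones, whose values at x are powers
    of one primitive root of unity z; the exponent k with nu z = z^k serves all
    of them. *)
Lemma aut_irr_expg (nu : {rmorphism algC -> algC}) x : x \in G ->
  exists2 k, coprime #[x]%g k & forall i : Iirr G, nu ('chi_i x) = 'chi_i (x ^+ k)%g.
Proof.
move=> Gx; have [z prim_z] := C_prim_root_exists (order_gt0 x).
have [k nu_z] : exists k, nu z = z ^+ k.
  have [|k ->] := (prim_rootP prim_z) (nu z); last by exists k.
  by rewrite -rmorphXn (prim_expr_order prim_z) rmorph1.
exists k => [|i].
  rewrite coprime_sym -(prim_root_exp_coprime _ prim_z) -nu_z.
  by rewrite fmorph_primitive_root.
have sxG: <[x]>%g \subset G by rewrite cycle_subG.
have /char_sum_irr[r chi_r] := cfRes_char <[x]>%g (irr_char i).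
have chiE j: 'chi_i (x ^+ j)%g = \sum_(l <- r) 'chi_l x ^+ j.
  rewrite -(cfResE _ sxG) ?mem_cycle // chi_r sum_cfunE; apply: eq_bigr => l _.
  by rewrite lin_charX ?cycle_id // (char_abelianP _ (cycle_abelian x)).
rewrite -[x in nu (_ x)]expg1 !chiE rmorph_sum; apply: eq_bigr => l _ /=.
have [|j ->] := (prim_rootP prim_z) ('chi_l x).
  by rewrite lin_char_unity_root ?cycle_id // (char_abelianP _ (cycle_abelian x)).
by rewrite expr1 rmorphXn nu_z exprAC.
Qed.

(** In the intended case f embeds a Galois extension K of the rationals and s lists
    extensions of its automorphisms to algC: the product is the norm of a. *)
Definition rational_norm (K : fieldType) (f : {rmorphism K -> algC})
    (s : seq {rmorphism algC -> algC}) :=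
  forall a, \prod_(nu <- s) nu (f a) \in Crat.

Lemma char_norm_exists :
  exists (K : fieldType) (f : {rmorphism K -> algC}) (s : seq {rmorphism algC -> algC}),
    [/\ (0 < size s)%N, rational_norm f s
      & forall (i : Iirr G) x, exists a, f a = 'chi_i x].
Proof.
have [Qn galQn [QnC gQnC [_ _ Qn_g]]] := group_num_field_exists G.
exists Qn, QnC, [seq sval (gQnC nu) | nu in 'Gal({:Qn} / 1)%g]; split.
- by rewrite size_map -cardE cardG_gt0.
- move=> a; rewrite big_map big_enum /=.
  have -> : \prod_(nu in 'Gal({:Qn} / 1)%g) sval (gQnC nu) (QnC a)
          = QnC (galNorm 1 {:Qn} a).
    rewrite rmorph_prod; apply: eq_bigr => nu _.
    by case: (gQnC nu) => g /= ->.
  have /vlineP[/= c ->] := mem_galNorm galQn (memvf a).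
  by rewrite alg_num_field fmorph_rat rpred_rat.
move=> i x; have [Gx | G'x] := boolP (x \in G); last first.
  by exists 0; rewrite rmorph0 cfun0.
by have [a] := Qn_g _ G _ (irr_char i) x (order_dvdG Gx); exists a.
Qed.

(** The norm of a would be a nonzero integer divisible by every power of q. *)
Lemma Aint_divisible_eq0 (K : fieldType) (f : {rmorphism K -> algC}) s (q : nat) a :
    rational_norm f s -> (0 < size s)%N -> (1 < q)%N ->
  (forall k, f a / q%:R ^+ k \in Aint) -> a = 0.
Proof.
move=> ratN s_gt0 q_gt1 a_dvd; apply/eqP/contraT => nz_a.
have nz_q : q%:R != 0 :> algC by rewrite pnatr_eq0 -lt0n ltnW.
pose N := \prod_(nu <- s) nu (f a).
have nz_N: N != 0.
  rewrite /N; apply: (big_ind (fun N => N != 0)) => [|b c nz_b nz_c|nu _];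
    rewrite ?oner_eq0 ?mulf_neq0 //.
  by rewrite !fmorph_eq0.
have Z_N k: N / q%:R ^+ (k * size s) \in Num.int.
  apply: Cint_rat_Aint; first by rewrite rpred_div ?rpredX ?rpred_nat ?ratN.
  have -> : N / q%:R ^+ (k * size s) = \prod_(nu <- s) nu (f a / q%:R ^+ k).
    under eq_bigr do rewrite fmorph_div rmorphXn rmorph_nat.
    by rewrite prodf_div big_const_seq count_predT iter_mulr_1 exprM.
  by rewrite rpred_prod // => nu _; rewrite Aint_aut a_dvd.
have{Z_N} N_ge k: q%:R ^+ k <= `|N|.
  have: `|N / q%:R ^+ (k * size s)| >= 1.
    by rewrite norm_intr_ge1 // mulf_neq0 // invr_eq0 expf_neq0.
  rewrite normrM normfV normrX normr_nat ler_pdivlMr ?mul1r; last first.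
    by rewrite exprn_gt0 // ltr0n ltnW.
  apply: le_trans; rewrite -!natrX ler_nat leq_exp2l //.
  by rewrite -{1}[k]muln1 leq_mul2l s_gt0 orbT.
have /natrP[c Dc] : `|N| \in Num.nat.
  apply: natr_norm_int; have := ratN a; rewrite -/N => ?.
  apply: Cint_rat_Aint => //; rewrite rpred_prod // => nu _.
  by rewrite Aint_aut -[f a]divr1 (a_dvd 0%N).
by have := N_ge c; rewrite Dc -natrX ler_nat leqNgt ltn_expl.
Qed.

(** m is the norm of the scalar of the class of x: its conjugates are the scalars
    of the classes of generators of <x>, and so m is a scalar family. For a linear
    character all the conjugates have absolute value |x^G|. *)
Lemma integral_scalar_family x : x \in G ->
  exists m : Iirr G -> int,
    [/\ scalar_family (fun i => (m i)%:~R),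
        forall i, 'chi_i x = 0 -> m i = 0
      & forall i, 'chi_i \is a linear_char ->
          exists k, `|m i|%N = (#|x ^: G|%g ^ k)%N].
Proof.
move=> Gx; have [K [f [s [s_gt0 ratN irrK]]]] := char_norm_exists.
(* x and x ^+ k generate the same cyclic group, hence have the same centralizer. *)
have class_scalar_nu (nu : {rmorphism algC -> algC}) :
  exists2 y, y \in G & forall i : Iirr G, nu (class_scalar x i) = class_scalar y i.
  have [k co_k nuE] := aut_irr_expg nu Gx; exists (x ^+ k)%g; rewrite ?groupX //.
  move=> i; rewrite /class_scalar fmorph_div rmorphM rmorph_nat nuE.
  have -> : #|x ^: G|%g = #|(x ^+ k) ^: G|%g.
    have /eqP gen_xk: generator <[x]>%g (x ^+ k)%g by rewrite generator_coprime.
    by rewrite -!index_cent1 -!cent_cycle -gen_xk.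
  by rewrite irr1_degree rmorph_nat.
have m_int (i : Iirr G) : \prod_(nu <- s) nu (class_scalar x i) \in Num.int.
  apply: Cint_rat_Aint.
    have [a Da] := irrK i x.
    have -> : class_scalar x i = f (#|x ^: G|%:R * a / (Num.truncn ('chi_i 1%g))%:R).
      by rewrite fmorph_div rmorphM !rmorph_nat Da truncnK ?Cnat_irr1.
    exact: ratN.
  by rewrite rpred_prod // => nu _; rewrite Aint_aut Aint_class_div_irr1.
have /fin_all_exists[m mE] (i : Iirr G) :
    exists z : int, \prod_(nu <- s) nu (class_scalar x i) = z%:~R.
  by apply/intrP.
exists m; split.
- have w_nu (nu : {rmorphism algC -> algC}) :
      scalar_family (fun i : Iirr G => nu (class_scalar x i)).
    have [y Gy nuE] := class_scalar_nu nu.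
    have [T [w [Gw wE]]] := scalar_family_class Gy; exists T, w; split=> // i g Gg.
    by rewrite nuE wE.
  have [T [w [Gw wE]]] := scalar_family_prod s w_nu.
  by exists T, w; split=> // i g Gg; rewrite -mE wE.
- move=> i chix0; apply/eqP; rewrite -(eqr_int algC) -mE.
  case: s s_gt0 {ratN m_int mE} => // nu s _.
  by rewrite big_cons /class_scalar chix0 mulr0 mul0r rmorph0 mul0r.
move=> i lin_i; exists (size s); apply/eqP.
rewrite -(eqr_nat algC) pmulrn abszE intr_norm -mE normr_prod.
rewrite (eq_bigr (fun=> #|x ^: G|%:R)) => [|nu _].
  by rewrite big_const_seq count_predT iter_mulr_1 natrX.
have [k _ nuE] := aut_irr_expg nu Gx.
rewrite /class_scalar lin_char1 // divr1 rmorphM rmorph_nat nuE normrM normr_nat.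
by rewrite normC_lin_char ?groupX ?mulr1.
Qed.
End Galois.

(** * Conjugacy classes of prime power size *)

Section PrimePowerClass.
Local Open Scope ring_scope.
Import Order.TTheory Num.Theory.
Variables (gT : finGroupType) (G : {group gT}).

Lemma scalar_familyX (m : Iirr G -> algC) n :
  scalar_family m -> scalar_family (fun i => m i ^+ n).
Proof.
move=> wm; have [T [w [Gw wE]]] := scalar_family_prod (iota 0 n) (fun _ : nat => wm).
exists T, w; split=> // i g Gg.
by rewrite wE // big_const_seq count_predT size_iota iter_mulr_1.
Qed.

(** The set of i with m i prime to q is a union of q-blocks, and y is q-singular:
    this is the orthogonality of the columns of 1 and y inside blocks. With the
    weights (m i)^(2(q-1)q^n) in place of the indicator, the sum over all i is
    divisible by a power of q that grows with n. *)
Lemma block_sum_eq0 (m : Iirr G -> int) q y :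
    scalar_family (fun i => (m i)%:~R) -> prime q -> y \in G -> (q %| #[y]%g)%N ->
  \sum_(i | ~~ (q%:Z %| m i)%Z) 'chi_i 1%g * 'chi_i y = 0.
Proof.
move=> wm q_pr Gy q_y; pose B i := ~~ (q%:Z %| m i)%Z.
have [K [f [s [s_gt0 ratN irrK]]]] := char_norm_exists G.
have /fin_all_exists[c Dc] (i : Iirr G) : exists a, f a = 'chi_i 1%g * 'chi_i y.
  have [[a <-] [b <-]] := (irrK i 1%g, irrK i y).
  by exists (a * b); rewrite rmorphM.
have Zc (i : Iirr G) : 'chi_i 1%g * 'chi_i y \in Aint by rewrite rpredM ?Aint_irr.
have alphaE: f (\sum_(i | B i) c i) = \sum_(i | B i) 'chi_i 1%g * 'chi_i y.
  by rewrite rmorph_sum; apply: eq_bigr => i _; rewrite /= Dc.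
suffices c0: \sum_(i | B i) c i = 0 by rewrite -[LHS]alphaE c0 rmorph0.
apply: (Aint_divisible_eq0 ratN s_gt0 (prime_gt1 q_pr)) => k.
have nz_qk: q%:R ^+ k != 0 :> algC by rewrite expf_neq0 // pnatr_eq0 -lt0n prime_gt0.
(* The exponent leaves q ^ k after the loss of the q-part of |G|. *)
pose n := (k + logn q #|G|)%N.
have wm' : scalar_family (fun i => (m i)%:~R ^+ 2 ^+ q.-1) by do 2!apply: scalar_familyX.
have [d Dd] := scalar_family_exp_dvd n wm' q_pr Gy q_y.
have /fin_all_exists[z Dz] (i : Iirr G) :
    exists z : int, (m i ^+ 2 ^+ q.-1) ^+ (q ^ n) = (B i)%:R + z * q%:Z ^+ n.
  have /dvdzP[z Dz] := exp_primepow_indicator n (m i) q_pr.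
  by exists z; rewrite -Dz addrC subrK.
pose S := \sum_i (z i)%:~R * ('chi[G]_i 1%g * 'chi_i y).
have alpha_mod: f (\sum_(i | B i) c i) = (d * q ^ k)%:R - (q ^ n)%:R * S.
  rewrite -[k](addnK (logn q #|G|)) -Dd alphaE; apply/eqP.
  rewrite eq_sym subr_eq /S mulr_sumr [X in _ == X + _]big_mkcond -big_split /=.
  apply/eqP/eq_bigr => i _.
  rewrite -!rmorphXn Dz rmorphD rmorphM rmorph_nat rmorphXn natrX /= mulrDr.
  congr (_ + _); first by case: (B i); rewrite ?mulr1 ?mulr0.
  by rewrite mulrC -mulrA mulrCA.
have -> : f (\sum_(i | B i) c i) / q%:R ^+ k = d%:R - (q ^ logn q #|G|)%:R * S.
  apply: (canLR (mulfK nz_qk)); rewrite alpha_mod mulrBl -natrX -natrM.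
  by rewrite mulrAC -natrM -expnD addnC.
rewrite rpredB ?rpredM ?rpred_nat ?rpred_sum // => i _.
by rewrite rpredM ?Zc ?Aint_Cint ?intr_int.
Qed.

(** The elements of order q <> p in G' give a vanishing sum over the characters
    with m prime to q. Modulo p only the linear ones contribute, each of them 1,
    because Burnside's argument makes p divide the degree of every other chi with
    chi(x) <> 0. *)
Theorem primepow_class_der1_pgroup x p a :
    prime p -> x \in G -> #|x ^: G|%g = (p ^ a)%N ->
    (forall i : Iirr G, x \in 'Z('chi_i)%CF -> 'chi_i \is a linear_char) ->
    ~~ (p %| #|G : G^`(1)|%g)%N ->
  p.-group (G^`(1))%g.
Proof.
move=> p_pr Gx xGp Zx p'GG'; apply/pgroupP=> q q_pr qG'; rewrite inE.
apply: contraR p'GG' => q_neq_p.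
have [y G'y Dy] := Cauchy q_pr qG'.
have Gy: y \in G by apply: subsetP (der_sub 1 G) _ G'y.
have [m [wm m0 m_lin]] := integral_scalar_family Gx.
have := block_sum_eq0 wm q_pr Gy; rewrite Dy => /(_ (dvdnn q)).
have nz_p: p%:R != 0 :> algC by rewrite pnatr_eq0 -lt0n prime_gt0.
pose lin := [pred i | 'chi[G]_i \is a linear_char].
(* Every linear character is in the range of summation. *)
rewrite (bigID lin) /=.
rewrite (eq_big lin (fun=> 1)); first last.
- move=> i /andP[_ lin_i]; rewrite lin_char1 // mul1r.
  by rewrite (cfker1 (subsetP (lin_char_der1 lin_i) _ G'y)) lin_char1.
- move=> i /=; apply: andb_idl => lin_i.
  have [k Dk] := m_lin i lin_i; rewrite dvdzE /= Dk xGp -expnM Euclid_dvdX //.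
  by rewrite dvdn_prime2 // (negPf q_neq_p).
rewrite sumr_const card_lin_irr => /eqP.
rewrite addr_eq0 => /eqP Dsum.
rewrite -(dvdC_nat p) unfold_in (negPf nz_p).
apply: Cint_rat_Aint; first by rewrite rpred_div ?rpred_nat.
rewrite -[X in X / _]/(#|G : G^`(1)|%g%:R) Dsum mulNr rpredN mulr_suml.
rewrite rpred_sum // => i /andP[q'm nlin_i].
rewrite mulrAC rpredM ?Aint_irr //.
(* A nonlinear character in the range of summation does not vanish at x. *)
suffices /dvdCP[c Zc ->] : (p %| 'chi_i 1%g)%C by rewrite mulfK ?Aint_Cint.
rewrite irr1_degree dvdC_nat; apply: contraR q'm => p'chi1.
rewrite m0 // coprime_degree_support_cfcenter //; last first.
  by apply: contra nlin_i; apply: Zx.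
by rewrite xGp irr1_degree natrK coprime_sym coprimeXl // prime_coprime.
Qed.
End PrimePowerClass.

Section PrimePowerClassSolvable.
Variable gT : finGroupType.
Implicit Types G N : {group gT}.

(** Then |chi_i| is constant on G, and chi_i has norm 1. *)
Lemma cfcenter_full_linear G (i : Iirr G) :
  G \subset 'Z(('chi_i)%R)%CF -> ('chi_i)%R \is a linear_char.
Proof.
move=> /subsetP sGZ; rewrite qualifE /= irr_char /=.
rewrite -(@Num.Theory.pexpr_eq1 _ _ 2) ?char1_ge0 ?irr_char //.
apply/eqP; rewrite -(cfnorm_irr i) (cfnormE (cfun_onG _)).
rewrite (eq_bigr (fun=> 'chi_i 1%g ^+ 2)%R) => [|g Gg].
  by rewrite sumr_const -[X in (_ * X)%R]mulr_natl mulrA mulVf ?mul1r // neq0CG.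
by have := sGZ g Gg; rewrite irr_cfcenterE // => /eqP->.
Qed.

(** The p-part u of x is centralized by the centralizer of x, so that its own
    centralizer C has p-power index and G = C P for a Sylow p-subgroup P
    containing u. All conjugates of u are then P-conjugates, and they generate a
    normal p-subgroup. *)
Lemma primepow_class_constt_pcore G x p a :
  prime p -> x \in G -> #|x ^: G| = (p ^ a)%N ->
  x.`_p \in 'O_p(G).
Proof.
move=> p_pr Gx xGp; set u := x.`_p.
have Gu: u \in G by rewrite groupX.
have pu: p.-elt u by apply: p_elt_constt.
have index_p: p.-nat #|G : 'C_G[u]|.
  have sCC: 'C_G[x] \subset 'C_G[u].
    apply: setIS; apply/subsetP=> c /cent1P cx.
    by apply/cent1P/commuteX.
  apply: (@pnat_dvd _ #|G : 'C_G[x]|); first exact: indexgS.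
  by rewrite index_cent1 xGp pnatX pnat_id ?orbT.
have [|P sylP] := Sylow_superset (_ : <[u]> \subset G) pu; rewrite ?cycle_subG //.
have [sPG pP p'GP] := and3P sylP => uP.
have DG: 'C_G[u] * P = G.
  by apply: coprime_index_mulG (pnat_coprime index_p p'GP); rewrite ?subsetIl.
have sUP: u ^: G \subset P.
  apply/subsetP=> _ /imsetP[g Gg ->]; move: Gg; rewrite -DG => /mulsgP[c y].
  by case/setIP=> _ /cent1P cu Py ->; rewrite conjgM (conjgE u c) -cu mulKg groupJ.
have nsUG: <<u ^: G>> <| G.
  by rewrite /normal gen_subG class_subG // norms_gen // class_norm.
apply: subsetP (pcore_max (pgroupS _ pP) nsUG) _ _; first by rewrite gen_subG.
by rewrite mem_gen ?class_refl.
Qed.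

(** G' <x> is normal, as it contains G'; it contains x, hence it is G. *)
Lemma index_der1_gen_class G x : x \in G -> <<x ^: G>> = G -> #|G : G^`(1)| %| #[x].
Proof.
move=> Gx genG; have nG'G := der_norm 1 G.
have DG: G^`(1) <*> <[x]> = G.
  apply/eqP; rewrite eqEsubset join_subG der_sub cycle_subG Gx /=.
  rewrite -{1}genG gen_subG class_sub_norm ?mem_gen //.
    by rewrite inE cycle_id orbT.
  rewrite normal_norm // sub_der1_normal ?joing_subl //.
  by rewrite join_subG der_sub cycle_subG.
have nG'x: <[x]> \subset 'N(G^`(1)) by rewrite cycle_subG (subsetP nG'G).
rewrite -card_quotient // -{1}DG quotientYidl //.
by rewrite quotient_cycle ?(subsetP nG'G) // morph_order // (subsetP nG'G).
Qed.

Theorem primepow_class_solvable G x p a :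
    prime p -> x \in G -> <<x ^: G>> = G -> #|x ^: G| = (p ^ a)%N ->
    (forall N, N <| G -> N :!=: 1 -> G^`(1) \subset N) ->
  solvable G.
Proof.
move=> p_pr Gx genG xGp minG'.
have linZ (i : Iirr G) : x \in 'Z(('chi_i)%R)%CF -> ('chi_i)%R \is a linear_char.
  move=> Zx; apply: cfcenter_full_linear; rewrite -{1}genG gen_subG.
  by rewrite class_sub_norm ?normal_norm ?cfcenter_normal.
suffices pG': p.-group G^`(1).
  by rewrite (series_sol (der_normal 1 G)) (pgroup_sol pG') abelian_sol ?der_abelian.
have [Op1 | ntOp] := eqVneq 'O_p(G) 1; last first.
  exact: pgroupS (minG' _ (pcore_normal p G) ntOp) (pcore_pgroup p G).
apply: (primepow_class_der1_pgroup p_pr Gx xGp linZ).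
have := primepow_class_constt_pcore p_pr Gx xGp; rewrite Op1 => /set1P xp1.
apply/negP=> p_G; have: p %| #[x] by apply: dvdn_trans (index_der1_gen_class Gx genG).
by apply/negP; rewrite -p'natE //; apply/constt1P.
Qed.

End PrimePowerClassSolvable.

(** * The inner group of a simple crossed set *)

Section SimpleRack.
Variables (X : finType) (op : X -> X -> X).
Hypotheses (hcrossed : is_crossed_set op) (hsimple : simple_rack op).

Let opI i : injective (op i).
Proof. by case: hcrossed => [[_ bij_op _] _ _]; apply: bij_inj. Qed.
Let opA i j k : op i (op j k) = op (op i j) (op i k).
Proof. by case: hcrossed => [[]]. Qed.
Let opii i : op i i = i.
Proof. by case: hcrossed. Qed.

(** Simplicity, phrased for the congruence of equality of f-values. The quotient
    is realized on the fixed points of a choice r of representatives. *)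
Lemma simple_rack_congruence (T : eqType) (f : X -> T) :
    (forall i i' j j', f i = f i' -> f j = f j' -> f (op i j) = f (op i' j')) ->
  (forall i j, f i = f j) \/ injective f.
Proof.
move=> f_op; pose r i := choose (fun j => f j == f i) i.
have fr i: f (r i) = f i by apply/eqP/(chooseP (P := fun j => f j == f i)).
have r_eq i j: f i = f j -> r i = r j.
  move=> fij; rewrite /r fij; apply: choose_id => //; exact/eqP.
have rr i: r (r i) == r i by apply/eqP/r_eq.
pose Y := {i | r i == i}.
have rY (y : Y) : r (val y) = val y by apply/eqP; apply: (valP y).
pose pi i : Y := exist (fun j => r j == j) (r i) (rr i).
pose opY (a b : Y) := pi (op (val a) (val b)).
have pi_op: rack_morphism op opY pi.
  by move=> i j; apply: val_inj; apply: r_eq; apply: f_op; rewrite fr.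
have pi_surj y: exists i, pi i = y.
  by exists (val y); apply: val_inj; rewrite /= rY.
have opYI a: injective (opY a).
  apply/injectiveP/card_uniqP; rewrite size_map -cardT; apply/eq_card=> b.
  rewrite [RHS]inE; apply/codomP.
  have [i Da] := pi_surj a; have [j Db] := pi_surj b.
  have [h _ opK] := injF_bij (@opI i).
  by exists (pi (h j)); rewrite -Da -pi_op opK.
have rackY: is_rack opY.
  split=> [|a|a b c]; last first.
  - have [[[i <-] [j <-]] [k <-]] := (pi_surj a, pi_surj b, pi_surj c).
    by rewrite -!pi_op opA.
  - exact: injF_bij.
  by case: hcrossed => [[[i] _ _] _ _]; constructor; apply: pi i.
have f_pi i j: pi i = pi j -> f i = f j by move/(congr1 val)/(congr1 f); rewrite /= !fr.
have [_ _ /(_ Y opY pi rackY pi_op pi_surj) [Y1 | YX]] := hsimple.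
  left=> i j; apply: f_pi; have /fintype1[y0 Dy] := Y1.
  by rewrite [LHS]Dy [RHS]Dy.
right=> i j fij; suffices: injective pi by apply; apply: val_inj; apply: r_eq.
apply/injectiveP/card_uniqP; rewrite size_map -cardT -YX; apply/eq_card=> y.
by rewrite [RHS]inE; apply/codomP; have [k <-] := pi_surj y; exists k.
Qed.

Definition inner (i : X) : {perm X} := perm (@opI i).
Local Notation G := (Inn op).

Lemma innerE i j : inner i j = op i j. Proof. exact: permE. Qed.

Lemma InnE : G :=: <<[set inner i | i : X]>>.
Proof.
congr <<_>>; apply/setP=> s; rewrite inE.
apply/existsP/imsetP=> [[i /forallP opi] | [i _ ->]]; exists i => //.
  by apply/permP=> j; rewrite innerE (eqP (opi j)).
by apply/forallP=> j; rewrite innerE.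
Qed.

Lemma mem_inner i : inner i \in G.
Proof. by rewrite InnE mem_gen // imset_f. Qed.

(** The rack automorphisms form a group containing all inner i. *)
Lemma Inn_morph g i j : g \in G -> g (op i j) = op (g i) (g j).
Proof.
pose A := [set h : {perm X} | [forall i, forall j, h (op i j) == op (h i) (h j)]].
have AP (h : {perm X}) : reflect (forall i j, h (op i j) = op (h i) (h j)) (h \in A).
  rewrite inE; apply: (iffP forallP) => [hA i1 j1 | hA i1].
    by apply/eqP; move/forallP: (hA i1).
  by apply/forallP=> j1; apply/eqP.
have gA: group_set A.
  apply/group_setP; split=> [|h1 h2 /AP h1A /AP h2A].
    by apply/AP=> k l; rewrite !perm1.
  by apply/AP=> k l; rewrite !permM h1A h2A.
suffices sGA: G \subset Group gA by move/(subsetP sGA)/AP.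
rewrite InnE gen_subG; apply/subsetP=> _ /imsetP[k _ ->]; apply/AP=> l m.
by rewrite !innerE opA.
Qed.

Lemma innerJ g i : g \in G -> inner i ^ g = inner (g i).
Proof.
move=> Gg; apply/permP=> j; rewrite conjgE !permM !innerE Inn_morph //.
by rewrite permKV.
Qed.

(** If inner were constant, then op i j = op j j = j for all i and j. *)
Lemma inner_inj : injective inner.
Proof.
have [i i' j j' Di Dj | const_inner | //] := simple_rack_congruence (f := inner).
  by rewrite -!(innerE, innerJ) ?mem_inner // Di Dj.
case: hsimple => _ ntriv _; case: ntriv => i j.
by rewrite -innerE (const_inner i j) innerE opii.
Qed.

(** The orbits of a normal subgroup N are the classes of a congruence; if they
    were singletons, N would be trivial. *)
Lemma normal_Inn_trans (N : {group {perm X}}) i j :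
  N <| G -> N :!=: 1 -> exists2 n, n \in N & n i = j.
Proof.
case/andP=> sNG nNG ntN.
have Norb k l: (orbit 'P N k = orbit 'P N l) <-> (exists2 n, n \in N & n k = l).
  split=> [/orbit_eqP/orbitP[m Nm <-] | [n Nn <-]].
    by exists m^-1; rewrite ?groupV // permK.
  by apply/esym/orbit_eqP; apply: mem_orbit.
have [k k' l l' /Norb[n Nn <-] /Norb[m Nm <-] | const | inj] :=
  simple_rack_congruence (f := orbit 'P N).
(* op (n k) (m l) = h (op k l) for the h below, since inner (n k) = inner k ^ n. *)
- apply/Norb; exists ((m * n^-1) ^ inner k * n).
    by rewrite groupM // memJ_norm ?groupM ?groupV ?(subsetP nNG) ?mem_inner.
  rewrite -(innerE (n k)) -innerJ ?(subsetP sNG) // !conjgE -[op k l]innerE.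
  by rewrite -!permM !mulgA mulgV mul1g.
- by apply/Norb; apply: const.
case/trivgPn: ntN => n Nn /eqP[]; apply/permP=> k; rewrite perm1; apply: inj.
by apply/esym/Norb; exists n.
Qed.

Lemma Inn_neq1 : G :!=: 1.
Proof.
apply/eqP=> G1; case: hsimple => _ ntriv _; case: ntriv => i j.
by have := mem_inner i; rewrite G1 => /set1P inner1; rewrite -innerE inner1 perm1.
Qed.

Lemma Inn_trans i j : exists2 g, g \in G & g i = j.
Proof. exact: normal_Inn_trans (normal_refl G) Inn_neq1. Qed.

Lemma class_inner i : inner i ^: G = [set inner j | j : X].
Proof.
apply/setP=> s; apply/imsetP/imsetP=> [[g Gg ->] | [j _ ->]].
  by exists (g i); rewrite ?innerJ.
by have [g Gg <-] := Inn_trans i j; exists g; rewrite ?innerJ.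
Qed.

Lemma card_class_inner i : #|inner i ^: G| = #|X|.
Proof. by rewrite class_inner card_imset //; apply: inner_inj. Qed.

Lemma gen_class_inner i : <<inner i ^: G>> = G.
Proof. by rewrite class_inner -InnE. Qed.

Lemma center_Inn : 'Z(G) = 1.
Proof.
apply/trivgP/subsetP=> z /centerP[Gz cGz]; apply/set1P/permP=> i.
rewrite perm1; apply: inner_inj; rewrite -innerJ //.
by apply/conjg_fixP/commgP; apply/commute_sym/cGz/mem_inner.
Qed.

(** As N is transitive, every inner j is conjugate to inner i under N. *)
Lemma normal_Inn_mul_inner (N : {group {perm X}}) i :
  N <| G -> N :!=: 1 -> N * <[inner i]> = G.
Proof.
move=> nsNG ntN; have [sNG nNG] := andP nsNG; have Gi := mem_inner i.
have nNi: <[inner i]> \subset 'N(N) by rewrite cycle_subG (subsetP nNG).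
apply/eqP; rewrite -norm_joinEr // eqEsubset join_subG sNG cycle_subG Gi /=.
rewrite -{1}(gen_class_inner i) gen_subG; apply/subsetP=> s.
rewrite class_inner => /imsetP[j _ ->].
have [n Nn <-] := normal_Inn_trans i j nsNG ntN.
rewrite -innerJ ?(subsetP sNG) // groupJ ?mem_gen //.
  by rewrite inE cycle_id orbT.
by rewrite inE Nn.
Qed.

Lemma der1_Inn_sub (N : {group {perm X}}) :
  N <| G -> N :!=: 1 -> G^`(1) \subset N.
Proof.
move=> nsNG ntN; have [[[i] _ _] _ _] := hcrossed.
rewrite der1_min ?normal_norm // -(normal_Inn_mul_inner i nsNG ntN).
by rewrite quotientMidl quotient_abelian // cycle_abelian.
Qed.

Lemma der1_Inn_neq1 : G^`(1) != 1.
Proof.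
apply: contra Inn_neq1 => /eqP/derG1P cGG.
by rewrite -center_Inn (center_idP cGG).
Qed.

Lemma minnormal_der1_Inn : minnormal G^`(1) G.
Proof.
apply/mingroupP; rewrite der1_Inn_neq1 normal_norm ?der_normal //.
split=> // N /andP[ntN nNG] sNG'; apply/eqP; rewrite eqEsubset sNG' /=.
by apply: der1_Inn_sub => //; rewrite /normal (subset_trans sNG' (der_sub 1 G)).
Qed.

End SimpleRack.

(** * The semidirect product *)

Section Semidirect.
Variable gT : finGroupType.
Implicit Types (G N : {group gT}) (x : gT).

Lemma solvable_sdprod_by (hT : finGroupType) (N : {group hT}) (A : {group {perm hT}})
    (sAN : A \subset Aut N) :
  solvable N -> solvable A -> solvable [set: sdprod_by ([Aut N] \ sAN)%gact].
Proof.
have defNA := sdprod_sdpair ([Aut N] \ sAN)%gact.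
move=> solN solA; have [nsN _ _ _ _] := sdprod_context defNA.
rewrite (series_sol nsN) morphim_sol //=.
by rewrite -(isog_sol (sdprod_isog defNA)) morphim_sol.
Qed.

(** Conjugation is injective on <x>: a power of x centralizing N commutes with x
    too, and so is central in G = N <x>. This also gives that N and <x> meet
    trivially. Subgroups of N normalized by x are normal in G because N is
    abelian, which turns minimality into irreducibility. *)
Lemma sdprod_conj_aut G N x :
    N <| G -> x \in G -> 'Z(G) = 1 -> abelian N -> N :!=: 1 -> minnormal N G ->
    N * <[x]> = G ->
  exists sCA : <[conj_aut N x]> \subset Aut N,
    [/\ conj_aut N x != 1,
        acts_irreducibly <[conj_aut N x]> N [Aut N]
      & G \isog [set: sdprod_by ([Aut N] \ sCA)%gact]].
Proof.
move=> nsNG Gx ZG abN ntN minN DG; have [sNG nNG] := andP nsNG.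
have nNx: x \in 'N(N) by apply: subsetP nNG _ Gx.
have sCA: <[conj_aut N x]> \subset Aut N by rewrite cycle_subG Aut_aut.
have cent_x_trivial k : x ^+ k \in 'C(N) -> x ^+ k = 1.
  move=> cNxk; have: x ^+ k \in 'Z(G).
    rewrite inE groupX //= -DG centM inE cNxk /=.
    exact: subsetP (cycle_abelian x) _ (mem_cycle x k).
  by rewrite ZG => /set1P.
have conjXE k : conj_aut N x ^+ k = conj_aut N (x ^+ k) by rewrite morphX.
have ord_x : #[x] %| #[conj_aut N x].
  rewrite order_dvdn; apply/eqP/cent_x_trivial.
  rewrite -(ker_conj_aut N); apply/kerP; rewrite ?groupX //.
  by rewrite -[LHS]conjXE expg_order.
have ord_x' : #[conj_aut N x] %| #[x] by apply: morph_order.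
have x'E h : h \in N -> conj_aut N x h = h ^ x by apply: norm_conj_autE.
have x'A : conj_aut N x \in Aut N by apply: Aut_aut.
have actsE (H : {group gT}) : H \subset N ->
  [acts <[conj_aut N x]>, on H | [Aut N]] = (x \in 'N(H)).
  move=> sHN; rewrite cycle_subG 2!(x'A, inE) /= x'A [RHS]inE /=.
  apply/subsetP/subsetP=> [acH _ /imsetP[h Hh ->] | nHx h Hh].
    by have := acH h Hh; rewrite inE /= -x'E ?(subsetP sHN).
  rewrite inE /=; have := nHx (h ^ x); rewrite memJ_conjg => /(_ Hh).
  by rewrite -x'E ?(subsetP sHN).
exists sCA; split.
- apply: contraNneq ntN => x'1.
  have x1: x = 1.
    by apply/eqP; rewrite -order_eq1 -dvdn1 (dvdn_trans ord_x) // x'1 order1.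
  have : abelian G by rewrite -DG x1 cycle1 mulg1.
  by move/center_idP; rewrite ZG => G1; rewrite -subG1 G1.
- apply/mingroupP; rewrite ntN actsE //; split=> // H /andP[ntH acH] sHN.
  have [_ minNG] := mingroupP minN.
  apply: minNG => //; rewrite ntH -DG mul_subG ?cycle_subG -?actsE //.
  exact: sub_abelian_norm.
have act_f : {in N & <[conj_aut N x]>,
    morph_act ([Aut N] \ sCA)%gact 'J (idm N) (eltm ord_x)}.
  move=> h _ Nh /cycleP[k ->] /=; rewrite eltmE /= conjXE.
  exact: norm_conj_autE (groupX k nNx) Nh.
rewrite isog_sym; apply/isogP; exists (xsdprod_morphism act_f); last first.
  by rewrite im_xsdprodm im_idm im_eltm.
rewrite injm_xsdprodm injm_idm injm_eltm ord_x' /= im_idm im_eltm.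
apply/eqP/trivgP/subsetP=> z /setIP[/= Nz /cycleP[k Dz]].
by rewrite Dz in Nz *; rewrite cent_x_trivial ?inE // (subsetP abN).
Qed.

End Semidirect.

(** * The affine structure *)

Section Affine.
Variables (X : finType) (op : X -> X -> X).
Hypotheses (hcrossed : is_crossed_set op) (hsimple : simple_rack op).
Local Notation G := (Inn op).
Local Notation inner := (inner hcrossed).

(** N = G' is abelian and transitive, hence regular: an element fixing i0 fixes
    every m i0 with m in N. In terms of the bijection n |-> n i0 the operation is
    (a, b) |-> a (b a^-1)^x with x = inner i0. *)
Lemma solvable_simple_affine : solvable G ->
  exists (p t : nat) (T : 'M['F_p]_t),
    [/\ prime p, (1 <= t)%N, T \in unitmx, irreducible_mx T
      & rack_isomorphic op (affine (fun v : 'rV['F_p]_t => (v *m T)%R))].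
Proof.
move=> solG; have [[[i0] _ _] opii _] := hcrossed.
have minN := minnormal_der1_Inn hcrossed hsimple.
have [nNG ntN /is_abelemP[p p_pr abelN]] := minnormal_solvable minN (der_sub 1 G) solG.
have nsNG: G^`(1) <| G := der_normal 1 G.
have cNN := abelem_abelian abelN.
have DG := normal_Inn_mul_inner hcrossed hsimple i0 nsNG ntN.
pose x := inner i0; have Gx: x \in G := mem_inner hcrossed i0.
pose rG := abelem_repr abelN ntN nNG; pose E := rVabelem abelN ntN.
have NE v : E v \in G^`(1) by apply: mem_rVabelem.
have GE v : E v \in G by apply: subsetP (der_sub 1 G) _ (NE v).
exists p, _, (rG x); split=> //; first exact: repr_mx_unit.
- split=> // U stabU; have [-> | ntU] := eqVneq U 0%R; [by left | right].
  have /mx_irrP[_ irr_rG] : mx_irreducible rG by apply/abelem_mx_irrP.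
  apply: irr_rG => //.
  rewrite /mxmodule -{1}DG mul_subG ?cycle_subG //; last by rewrite inE Gx.
  (* N acts trivially on itself, so that a T-stable subspace is G-stable. *)
  have sNker: G^`(1) \subset rker rG.
    by rewrite rker_abelem subsetI der_sub.
  apply: subset_trans sNker _; apply/subsetP=> n /rkerP[Gn rGn].
  by rewrite inE Gn rGn mulmx1 /=.
pose g v : X := E v i0.
have g_surj i : exists v, g v = i.
  have [n Nn <-] := normal_Inn_trans hcrossed hsimple i0 i nsNG ntN.
  by exists (abelem_rV abelN ntN n); rewrite /g /E abelem_rV_K.
have g_inj: injective g.
  move=> u v guv; apply: (@rVabelem_inj _ _ _ abelN ntN); rewrite -/E.
  apply/eqP; rewrite eq_mulgV1; apply/eqP/permP=> j; rewrite perm1.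
  have [m <-] := g_surj j; rewrite /g -permM (centsP cNN) ?groupM ?groupV //.
  by rewrite !permM -/(g u) guv permK.
have xi0: x i0 = i0 by rewrite innerE.
have g_morph u v : g (affine (fun v => (v *m rG x)%R) u v) = op (g u) (g v).
  rewrite /g /affine /E rVabelemD rVabelemJ // rVabelemD rVabelemN -/E.
  rewrite -(innerE hcrossed (E u i0)) -innerJ // -/x.
  transitivity ((x * (E u * (E v * (E u)^-1) ^ x)) i0); first by rewrite permM xi0.
  rewrite -[LHS]/(_ i0) -permM; congr (fun_of_perm _ _).
  have Nc: (E v * (E u)^-1) ^ x \in G^`(1).
    by rewrite memJ_norm ?(subsetP nNG) // groupM ?groupV.
  rewrite (centsP cNN _ (NE u) _ Nc).
  by rewrite !conjgE !mulgA mulgV mul1g.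
have /fin_all_exists[f fK] := g_surj.
exists f; first by exists g => // v; apply: g_inj; rewrite fK.
by move=> i j; rewrite -{1}[i]fK -{1}[j]fK -g_morph; apply: g_inj; rewrite fK.
Qed.
End Affine.

Theorem theorem3p9 (X : finType) (op : X -> X -> X)
    (hcrossed : is_crossed_set op) (hsimple : simple_rack op) :
  [<-> exists p t : nat, [/\ prime p, (1 <= t)%N & #|X| = (p ^ t)%N];
       solvable (Inn op);
       exists (p t : nat) (gT : finGroupType) (N : {group gT}) (x : {perm gT})
              (sCA : <[x]> \subset Aut N),
         [/\ prime p /\ (1 <= t)%N,
             p.-abelem N /\ #|N| = (p ^ t)%N,
             x != 1,
             acts_irreducibly <[x]> N [Aut N]
           & Inn op \isog [set: sdprod_by ([Aut N] \ sCA)%gact]];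
       exists (p t : nat) (T : 'M['F_p]_t),
         [/\ prime p, (1 <= t)%N, T \in unitmx, irreducible_mx T
           & rack_isomorphic op
               (affine (fun v : 'rV['F_p]_t => (v *m T)%R))]].
Proof.
have [[[i0] _ _] _ _] := hcrossed.
have Gi0 := mem_inner hcrossed i0.
tfae.
- case=> p [t [p_pr _ Xpt]].
  apply: (primepow_class_solvable p_pr Gi0 (gen_class_inner hcrossed hsimple i0)).
    by rewrite (card_class_inner hcrossed hsimple) Xpt.
  exact: der1_Inn_sub hcrossed hsimple.
- move=> solG; have minN := minnormal_der1_Inn hcrossed hsimple.
  have [_ ntN /is_abelemP[p p_pr abelN]] := minnormal_solvable minN (der_sub 1 _) solG.
  have nsN := der_normal 1 (Inn op).
  have [sCA [ntx irrx isoG]] := sdprod_conj_aut nsN Gi0 (center_Inn hcrossed hsimple)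
    (abelem_abelian abelN) ntN minN (normal_Inn_mul_inner hcrossed hsimple i0 nsN ntN).
  have oN := card_pgroup (abelem_pgroup abelN).
  exists p, (logn p #|(Inn op)^`(1)|), _, [group of (Inn op)^`(1)], _, sCA; split=> //.
  by split=> //; rewrite lt0n; apply: contraNneq ntN => t0; rewrite trivg_card1 oN t0.
- case=> p [t [gT [N [x [sCA [_ [abelN _] _ _ isoG]]]]]].
  apply: solvable_simple_affine => //; rewrite (isog_sol isoG).
  apply: solvable_sdprod_by; apply: abelian_sol; last exact: cycle_abelian.
  exact: abelem_abelian abelN.
case=> p [t [T [p_pr t_gt0 _ _ [f bij_f _]]]]; exists p, t; split=> //.
by rewrite (bij_eq_card bij_f) card_mx card_Fp // mul1n.
Qed.
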